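(* Let $S$ and $s$ be, respectively, the rational cubic spline fractal interpolation function (FIF), with scaling factors $\alpha_i$ satisfying $|\alpha_i|\le\kappa a_i$, $0\le\kappa<1$, and shape parameters $r_i>-1$, and the classical rational cubic spline interpolant (with the same derivative parameters $d_i$ and shape parameters $r_i$) for the original function $f\in\mathcal{C}^1(I)$ with respect to the interpolation data $\{(x_i,y_i): i=1,2,\dots,N\}$, $y_i=f(x_i)$. Suppose that the rational functions $R_i$ involved in generating $S$ satisfy, for some real constant $Z_0$, $$\left|\frac{\partial R_i(\tau_i,\phi)}{\partial\alpha_i}\right|\le Z_0\quad\text{for } |\tau_i|\in(0,\kappa a_i),\ \phi\in[0,1],\ \text{and all } i\in J.$$ Then $$\|f-S\|_\infty\le\frac{1}{4c}\,h\,|d|_\infty+\frac{1}{4c}\,\omega(f;h)\,(|r|_\infty+4)+\frac{|\alpha|_\infty(\|s\|_\infty+Z_0)}{1-|\alpha|_\infty},$$ where $c=\min\{c_i:i\in J\}$ and $\omega(f;h)=\sup\{|f(x)-f(x^* )|: x,x^*\in I,\ |x-x^*|\le h\}$ is the modulus of continuity of $f$. In particular, $S$ converges uniformly to $f\in\mathcal{C}^1(I)$ as the mesh norm tends to zero.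
   Context: Let $x_1<x_2<\dots<x_N$, $I=[x_1,x_N]$, $J=\{1,\dots,N-1\}$, $h_i=x_{i+1}-x_i$, $h=\max_{i\in J}h_i$ (the mesh norm), $a_i=h_i/(x_N-x_1)$, and let $L_i(x)=a_ix+b_i$ be the affine map with $L_i(x_1)=x_i$, $L_i(x_N)=x_{i+1}$. $\|\cdot\|_\infty$ is the uniform norm on $I$. Put $|d|_\infty=\max_{1\le i\le N}|d_i|$, $|r|_\infty=\max_{i\in J}|r_i|$, $|\alpha|_\infty=\max_{i\in J}|\alpha_i|$, and let $c_i=\frac{1+r_i}{4}$ if $-1<r_i<3$ and $c_i=1$ if $r_i\ge3$. Given values $y_i$, derivative parameters $d_i$ ($i=1,\dots,N$), scaling factors $\alpha_i$ with $|\alpha_i|\le\kappa a_i$ ($i\in J$, $0\le\kappa<1$ fixed) and shape parameters $r_i>-1$ ($i\in J$), the rational cubic spline FIF is the unique function $S\in\mathcal{C}^1(I)$ satisfying $$S(L_i(x))=\alpha_iS(x)+R_i(\alpha_i,\theta),\qquad \theta=\frac{x-x_1}{x_N-x_1},\quad x\in I,\ i\in J,$$ where, for real $\alpha_i$ and $\phi\in[0,1]$, $$R_i(\alpha_i,\phi)=\frac{P_i(\alpha_i,\phi)}{Q_i(\phi)},\qquad Q_i(\phi)=1+(r_i-3)\phi(1-\phi),$$ $$\begin{aligned}P_i(\alpha_i,\phi)={}&(y_i-\alpha_iy_1)(1-\phi)^3+\{[r_iy_i+h_id_i]-\alpha_i[r_iy_1+d_1(x_N-x_1)]\}\phi(1-\phi)^2\\&+\{[r_iy_{i+1}-h_id_{i+1}]-\alpha_i[r_iy_N-d_N(x_N-x_1)]\}\phi^2(1-\phi)+(y_{i+1}-\alpha_iy_N)\phi^3.\end{aligned}$$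 It satisfies $S(x_i)=y_i$ and $S^{(1)}(x_i)=d_i$ for all $i$. The classical rational cubic spline $s\in\mathcal{C}^1(I)$ is the case of all $\alpha_i=0$, i.e. $s(x)=R_i(0,\phi)$ with $\phi=(x-x_i)/h_i$ for $x\in[x_i,x_{i+1}]$; also $s^{(1)}(x_i)=d_i$. The notation $\partial R_i(\tau_i,\phi)/\partial\alpha_i$ means the partial derivative of $R_i$ in its first argument, evaluated at $(\tau_i,\phi)$.
   Formalization: The uniform convergence clause is stated for sequences of data along which 1/c and the derivative parameters |d|_∞ stay bounded; without this it fails (f=0, α_i=0, r_i=3, d_i=(−1)^i/h²). The error bound is unchanged. *)

(* Defs.v *)
From HB Require Import structures.
From mathcomp Require Import all_boot all_order all_algebra.
From mathcomp Require Import all_classical all_reals all_analysis.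
Set Implicit Arguments. Unset Strict Implicit. Unset Printing Implicit Defensive.
Import Order.TTheory GRing.Theory Num.Theory numFieldNormedType.Exports.
Local Open Scope classical_set_scope.
Local Open Scope ring_scope.

(* Knots x_1 < ... < x_N and the attached parameters are total functions on nat
   indexed from 1.  Only the values at 1 <= i <= N (for knot, value, slope) and
   at 1 <= i < N (for scaling, shape) are ever used. *)
Record spline_data (R : realType) := SplineData {
  npts : nat;               (* N *)
  knot : nat -> R;          (* x_i *)
  value : nat -> R;         (* y_i *)
  slope : nat -> R;         (* d_i *)
  scaling : nat -> R;       (* alpha_i *)
  shape : nat -> R }.       (* r_i *)

Definition xfirst (R : realType) (D : spline_data R) : R := knot D 1.
Definition xlast (R : realType) (D : spline_data R) : R := knot D (npts D).

(* The set J = {1, ..., N-1}. *)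
Definition piece (R : realType) (D : spline_data R) (i : nat) : bool :=
  (1 <= i < npts D)%N.

Definition step (R : realType) (D : spline_data R) (i : nat) : R :=
  knot D i.+1 - knot D i.

Definition ratio (R : realType) (D : spline_data R) (i : nat) : R :=
  step D i / (xlast D - xfirst D).

(* L_i(x) = a_i x + b_i with b_i = x_i - a_i x_1. *)
Definition Lmap (R : realType) (D : spline_data R) (i : nat) (x : R) : R :=
  ratio D i * x + (knot D i - ratio D i * xfirst D).

(* The maxima below are of nonnegative quantities (steps are positive for
   increasing knots), so the default value 0 does not affect them. *)
Definition mesh (R : realType) (D : spline_data R) : R :=
  \big[Num.max/0]_(1 <= i < npts D) step D i.

Definition slope_max (R : realType) (D : spline_data R) : R :=
  \big[Num.max/0]_(1 <= i < (npts D).+1) `|slope D i|.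

Definition shape_max (R : realType) (D : spline_data R) : R :=
  \big[Num.max/0]_(1 <= i < npts D) `|shape D i|.

Definition scaling_max (R : realType) (D : spline_data R) : R :=
  \big[Num.max/0]_(1 <= i < npts D) `|scaling D i|.

Definition cshape (R : realType) (r : R) : R := if r < 3 then (1 + r) / 4 else 1.

(* Every c_i is at most 1, so the default value 1 does not affect the minimum. *)
Definition cmin (R : realType) (D : spline_data R) : R :=
  \big[Num.min/1]_(1 <= i < npts D) cshape (shape D i).

Definition Qi (R : realType) (D : spline_data R) (i : nat) (phi : R) : R :=
  1 + (shape D i - 3) * phi * (1 - phi).

(* The scaling factor is a free variable alpha here, so that one can
   differentiate with respect to it. *)
Definition Pi (R : realType) (D : spline_data R) (i : nat) (alpha phi : R) : R :=
  let ell := xlast D - xfirst D in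
  let y1 := value D 1 in let yN := value D (npts D) in
  let d1 := slope D 1 in let dN := slope D (npts D) in
  let r := shape D i in
  (value D i - alpha * y1) * (1 - phi) ^+ 3
  + ((r * value D i + step D i * slope D i)
      - alpha * (r * y1 + d1 * ell)) * phi * (1 - phi) ^+ 2
  + ((r * value D i.+1 - step D i * slope D i.+1)
      - alpha * (r * yN - dN * ell)) * phi ^+ 2 * (1 - phi)
  + (value D i.+1 - alpha * yN) * phi ^+ 3.

Definition Ri (R : realType) (D : spline_data R) (i : nat) (alpha phi : R) : R :=
  Pi D i alpha phi / Qi D i phi.

(* C^1 on the closed interval [a, b]: difference quotients are restricted to
   [a, b], hence one-sided at the endpoints. *)
Definition C1_on (R : realType) (a b : R) (f : R -> R) : Prop :=
  exists f' : R -> R,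
    {within `[a, b], continuous f'} /\
    (forall x, x \in `[a, b] ->
       (fun t => (f t - f x) / (t - x)) @ within `[a, b] x^' --> f' x).

Definition sup_norm (R : realType) (a b : R) (g : R -> R) : R :=
  sup [set `|g x| | x in `[a, b]].

Definition modulus (R : realType) (a b : R) (f : R -> R) (h : R) : R :=
  sup [set z | exists x t, [/\ x \in `[a, b], t \in `[a, b], `|x - t| <= h
                             & z = `|f x - f t|]].

Definition interpolation_data (R : realType) (a b : R) (f : R -> R) (kappa : R)
    (D : spline_data R) : Prop :=
  [/\ (2 <= npts D)%N,
      xfirst D = a /\ xlast D = b,
      forall i, piece D i -> knot D i < knot D i.+1,
      forall i, (1 <= i <= npts D)%N -> value D i = f (knot D i) &
      forall i, piece D i ->
        `|scaling D i| <= kappa * ratio D i /\ -1 < shape D i].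

(* The interpolation conditions S(x_i) = y_i and S'(x_i) = d_i follow from
   these two clauses; S is determined by them on [x_1, x_N]. *)
Definition is_spline_FIF (R : realType) (D : spline_data R) (S : R -> R) : Prop :=
  C1_on (xfirst D) (xlast D) S /\
  forall i x, piece D i -> x \in `[xfirst D, xlast D] ->
    S (Lmap D i x) = scaling D i * S x
      + Ri D i (scaling D i) ((x - xfirst D) / (xlast D - xfirst D)).

(* These equations determine s on [x_1, x_N]; that s is C^1 is a consequence. *)
Definition is_classical_spline (R : realType) (D : spline_data R) (s : R -> R) :
    Prop :=
  forall i x, piece D i -> x \in `[knot D i, knot D i.+1] ->
    s x = Ri D i 0 ((x - knot D i) / step D i).

Definition dRi_bounded (R : realType) (kappa : R) (D : spline_data R) (Z0 : R) :
    Prop :=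
  forall (i : nat) (tau phi : R), piece D i -> 0 < `|tau| < kappa * ratio D i ->
    phi \in `[0, 1] -> `|derive1 (fun alpha => Ri D i alpha phi) tau| <= Z0.

(* Main.v *)
(** Writing [u = phi (1 - phi)], the denominator is [Q_i = (1 - 3u) + r_i u >= c_i],
    and [Q_i (s - f)] is a combination of [y_i - f], [y_(i+1) - f], [h_i d_i] and
    [h_i d_(i+1)] with cubic weights, which bounds [f - s].  As [R_i] is affine in
    its first argument, [R_i (alpha_i) - R_i (0)] is at most [|alpha_i| Z_0], so the
    self-referential equation gives
    [|S - s| (L_i x) <= |alpha| (|S - s| (x) + ||s|| + Z_0)], and since the images
    of the [L_i] cover [I] this bounds [||S - s||].  For the convergence the same
    recursion is run on [f - S], with estimates of [R_i] and of its derivative that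
    do not involve the possibly unbounded [|r|]; the scaling factors vanish with
    the mesh because [|alpha_i| <= kappa h_i / (b - a)]. *)
Require Import Defs.
From mathcomp Require Import all_boot all_order all_algebra.
From mathcomp Require Import all_classical all_reals all_analysis.
From mathcomp Require Import ring lra.
Import Order.TTheory GRing.Theory Num.Theory numFieldNormedType.Exports.
Local Open Scope classical_set_scope.
Local Open Scope ring_scope.

Set Implicit Arguments.
Unset Strict Implicit.
Unset Printing Implicit Defensive.

(** * Continuity, boundedness and uniform continuity of [C1_on] functions *)

(** Near [x] the difference quotient stays within 1 of [f' x], so increments of [f] from [x] are at
    most [K = |f' x| + 1] times the distance. *)
Lemma C1_on_cvg (R : realType) (a b : R) (f : R -> R) (x e : R) :
  C1_on a b f -> x \in `[a, b] -> 0 < e ->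
  exists2 d, 0 < d & forall t, t \in `[a, b] -> `|x - t| < d -> `|f x - f t| < e.
Proof.
move=> [f' [_ hf']] xab e0; have /cvgrPdist_lt/(_ _ ltr01) := hf' x xab.
rewrite near_withinE => -[d /= d0 hd].
pose K : R := `|f' x| + 1; have K0 : 0 < K by rewrite /K ltr_wpDl.
exists (Num.min d (e / K)); first by rewrite lt_min d0 divr_gt0.
move=> t tab; rewrite lt_min => /andP[xtd xte].
have [->|tx] := eqVneq t x; first by rewrite subrr normr0.
have := hd t xtd tx tab.
set q := (f t - f x) / (t - x) => hq.
have qK : `|q| <= K.
  rewrite -[q](subKr (f' x)); apply: le_trans (ler_normB _ _) _.
  by rewrite /K lerD2l ltW.
have -> : f x - f t = q * (x - t).
  by rewrite -(opprB t x) mulrN /q mulfVK ?subr_eq0// opprB.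
rewrite normrM (@le_lt_trans _ _ (K * `|x - t|))// ?ler_wpM2r//.
by rewrite mulrC -ltr_pdivlMr.
Qed.

(** Compactness in near-covering form, with the candidate bound [M] running to infinity: each point
    only has to supply a local bound. *)
Lemma C1_on_bounded (R : realType) (a b : R) (f : R -> R) :
  C1_on a b f -> exists M, forall x, x \in `[a, b] -> `|f x| <= M.
Proof.
move=> hf; have /compact_near_coveringP cov := @segment_compact R a b.
have [|M [_ hM]] := cov R +oo%R (fun M x => x \in `[a, b] -> `|f x| <= M) _.
  move=> x xab; have [d d0 hd] := C1_on_cvg hf xab ltr01.
  exists (ball x d, [set M | `|f x| + 1 < M]); first split.
  - exact: nbhsx_ballx.
  - by exists (`|f x| + 1); split => //; exact: num_real.
  - move=> [y M] /= [xy fM] yab; apply: le_trans (ltW fM).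
    rewrite -[f y](subKr (f x)); apply: le_trans (ler_normB _ _) _.
    by rewrite lerD2l ltW// hd.
by exists (M + 1) => x xab; apply: hM => //; rewrite ltrDl.
Qed.

(** Heine-Cantor by the same covering argument, with [d] tending to 0 from the right. Half-radii
    keep both [y] and [t] within the radius of continuity around [x]. *)
Lemma C1_on_unif (R : realType) (a b : R) (f : R -> R) (e : R) :
  C1_on a b f -> 0 < e ->
  exists2 d, 0 < d & forall x t, x \in `[a, b] -> t \in `[a, b] ->
    `|x - t| < d -> `|f x - f t| < e.
Proof.
move=> hf e0; have /compact_near_coveringP cov := @segment_compact R a b.
have [|d /= d0 hd] := cov R (0:R)^'+ (fun d x => x \in `[a, b] ->
    forall t, t \in `[a, b] -> `|x - t| < d -> `|f x - f t| < e) _.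
  move=> x xab; have [d d0 hd] := C1_on_cvg hf xab (divr_gt0 e0 (ltr0Sn R 1)).
  exists (ball x (d / 2), [set y | y < d / 2]); first split.
  - by apply: nbhsx_ballx; rewrite divr_gt0.
  - by apply: nbhs_right_lt; rewrite divr_gt0.
  - move=> [y r] /= [xy rd] yab t tab yt.
    have yx : `|x - y| < d by rewrite (lt_trans xy)// ltr_pdivrMr// ltr_pMr// ltr1n.
    have tx : `|x - t| < d.
      rewrite (splitr d) (le_lt_trans (ler_distD y x t))// ltrD//.
      exact: lt_trans rd.
    rewrite (splitr e) (le_lt_trans (ler_distD (f x) _ _))// ltrD ?hd//.
    by rewrite distrC hd.
(* The half lies strictly inside the ball of radius [d] around 0 on which the property holds. *)
exists (d / 2) => [|x t xab]; first by rewrite divr_gt0.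
apply: hd => //=; last by rewrite divr_gt0.
by rewrite sub0r normrN gtr0_norm ?divr_gt0// ltr_pdivrMr// ltr_pMr// ltr1n.
Qed.

(** * Supremum norm, modulus of continuity and a contraction principle *)

(** The bound [M] makes the supremum genuine, since [sup] of an unbounded set is a default value;
    its size does not enter the conclusion. *)
Lemma le_sup_norm (R : realType) (a b : R) (g : R -> R) (M x : R) :
  (forall x, x \in `[a, b] -> `|g x| <= M) -> x \in `[a, b] ->
  `|g x| <= sup_norm a b g.
Proof.
move=> hM xab; apply: ub_le_sup; last by exists x.
by exists M => _ [y yab <-]; exact: hM.
Qed.

Lemma sup_norm_le (R : realType) (a b : R) (g : R -> R) (M : R) :
  a <= b -> (forall x, x \in `[a, b] -> `|g x| <= M) -> sup_norm a b g <= M.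
Proof.
move=> ab hM; apply: ge_sup => [|_ [y yab <-]]; last exact: hM.
by exists `|g a|, a => //=; rewrite bound_itvE.
Qed.

Lemma le_modulus (R : realType) (a b : R) (f : R -> R) (h x t : R) :
  C1_on a b f -> x \in `[a, b] -> t \in `[a, b] -> `|x - t| <= h ->
  `|f x - f t| <= modulus a b f h.
Proof.
move=> /C1_on_bounded[M hM] xab tab xt; apply: ub_le_sup; last by exists x, t.
exists (M + M) => _ [y [z [yab zab _ ->]]].
by apply: le_trans (ler_normB _ _) _; rewrite lerD ?hM.
Qed.

Lemma modulus_le (R : realType) (a b : R) (f : R -> R) (h e : R) :
  a <= b -> 0 <= h ->
  (forall x t, x \in `[a, b] -> t \in `[a, b] -> `|x - t| <= h ->
    `|f x - f t| <= e) ->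
  modulus a b f h <= e.
Proof.
move=> ab h0 he; apply: ge_sup => [|_ [x [t [xab tab xt ->]]]]; last exact: he.
have aab : a \in `[a, b] by rewrite bound_itvE.
by exists `|f a - f a|, a, a; split => //; rewrite subrr normr0.
Qed.

Lemma modulus_ge0 (R : realType) (a b : R) (f : R -> R) (h : R) :
  C1_on a b f -> a <= b -> 0 <= h -> 0 <= modulus a b f h.
Proof.
move=> hf ab h0; have aab : a \in `[a, b] by rewrite bound_itvE.
by apply: le_trans (le_modulus hf aab aab _) => //; rewrite subrr normr0.
Qed.

Lemma cvg_modulus (R : realType) (a b : R) (f : R -> R) (h : nat -> R) :
  C1_on a b f -> a <= b -> (forall n, 0 <= h n) -> h n @[n --> \oo] --> (0 : R) ->
  modulus a b f (h n) @[n --> \oo] --> (0 : R).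
Proof.
move=> hf ab h0 hh; apply/cvgrPdist_le => e e0.
have [d d0 hd] := C1_on_unif hf e0.
move/cvgrPdist_lt : hh => /(_ d d0); apply: filterS => n.
rewrite !sub0r !normrN ger0_norm// ger0_norm ?modulus_ge0// => hnd.
by apply: modulus_le => // x t xab tab xt; rewrite ltW// hd// (le_lt_trans xt).
Qed.

(** The supremum [m] of [|g|] satisfies [m <= A + k * m]; as [m] is finite thanks to [M], the last
    term can be absorbed. In the applications [z] is the image of [x] under some [L_i]. *)
Lemma contraction_bound (R : realType) (a b : R) (g : R -> R) (A k M : R) :
  a <= b -> 0 <= k -> k < 1 -> (forall x, x \in `[a, b] -> `|g x| <= M) ->
  (forall z, z \in `[a, b] ->
    exists2 x, x \in `[a, b] & `|g z| <= A + k * `|g x|) ->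
  forall z, z \in `[a, b] -> `|g z| <= A / (1 - k).
Proof.
move=> ab k0 k1 hM hg z zab; apply: le_trans (le_sup_norm hM zab) _.
rewrite ler_pdivlMr ?subr_gt0// mulrBr mulr1 lerBlDr.
apply: sup_norm_le => // y /hg[x xab gy]; apply: (le_trans gy).
by rewrite lerD2l mulrC ler_wpM2r// (le_sup_norm hM).
Qed.

(** * Rational cubic quotients *)

(** Common shape of two numerators: that of [R_i] at scaling 0, and that of the coefficient of the
    scaling factor in [R_i]. *)
Definition cubic_num (R : realType) (r A B p q phi : R) : R :=
  A * (1 - phi) ^+ 3 + (r * A + p) * phi * (1 - phi) ^+ 2
  + (r * B - q) * phi ^+ 2 * (1 - phi) + B * phi ^+ 3.

(** With [u = phi * (1 - phi)], the weights of [A] and [B] outside [r] add up to [1 - 3 * u], those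
    inside [r] to [u], and those of [p] and [q] to [u]. *)
Lemma cubic_num_le (R : realType) (r A B p q phi w m : R) :
  phi \in `[0, 1] -> `|A| <= w -> `|B| <= w -> `|p| <= m -> `|q| <= m ->
  `|cubic_num r A B p q phi| <=
    w * (1 - 3 * (phi * (1 - phi)) + `|r| * (phi * (1 - phi)))
    + m * (phi * (1 - phi)).
Proof.
rewrite in_itv /= => /andP[p0 p1] hA hB hp hq.
have p1' : 0 <= 1 - phi by rewrite subr_ge0.
have u0 : 0 <= phi * (1 - phi) by rewrite mulr_ge0.
have -> : cubic_num r A B p q phi =
   A * (1 - phi) ^+ 3 + B * phi ^+ 3
   + (r * (A * (phi * (1 - phi) * (1 - phi)) + B * (phi * (1 - phi) * phi))
   + (p * (phi * (1 - phi) * (1 - phi)) - q * (phi * (1 - phi) * phi))).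
  by rewrite /cubic_num; ring.
have le2 (C E x y v : R) : `|C| <= v -> `|E| <= v -> 0 <= x -> 0 <= y ->
    `|C * x + E * y| <= v * (x + y).
  move=> hC hE x0 y0; apply: le_trans (ler_normD _ _) _.
  by rewrite !normrM (ger0_norm x0) (ger0_norm y0) mulrDr lerD ?ler_wpM2r.
have -> : w * (1 - 3 * (phi * (1 - phi)) + `|r| * (phi * (1 - phi)))
     + m * (phi * (1 - phi)) = w * ((1 - phi) ^+ 3 + phi ^+ 3)
   + (`|r| * (w * (phi * (1 - phi) * (1 - phi) + phi * (1 - phi) * phi))
   + m * (phi * (1 - phi) * (1 - phi) + phi * (1 - phi) * phi)).
  by ring.
apply: le_trans (ler_normD _ _) (lerD _ _).
  by apply: le2; rewrite ?exprn_ge0.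
apply: le_trans (ler_normD _ _) (lerD _ _).
  by rewrite normrM ler_wpM2l// le2// mulr_ge0.
by rewrite -mulNr le2// ?normrN// mulr_ge0.
Qed.

Lemma mul_onem_le4 (R : realType) (phi : R) : phi * (1 - phi) <= 4^-1.
Proof. have := sqr_ge0 (phi - 2^-1); nra. Qed.

Lemma cshape_gt0 (R : realType) (r : R) : -1 < r -> 0 < cshape r.
Proof. by rewrite /cshape => r1; case: ifP => _ //; lra. Qed.

(** [Q_i] is affine in [u = phi * (1 - phi)], which ranges over [[0, 1/4]]; its values at the two
    ends are 1 and [(1 + r) / 4], and [cshape] is the smaller one. *)
Lemma cshape_le_Qi (R : realType) (D : spline_data R) (i : nat) (phi : R) :
  phi \in `[0, 1] -> cshape (Defs.shape D i) <= Qi D i phi.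
Proof.
rewrite in_itv /= => /andP[p0 p1].
rewrite /Qi /cshape -mulrA.
have u0 : 0 <= phi * (1 - phi) by rewrite mulr_ge0// subr_ge0.
have u4 := mul_onem_le4 phi.
move: u0 u4; set u := phi * _ => u0 u4; case: ifPn => [r3|]; first nra.
rewrite -leNgt => r3; nra.
Qed.

(** Inserting [u <= 1/4] bounds the numerator by [(m + w * (|r| + 4)) / 4], and the denominator is
    at least [c]. Leaving [c] free allows the global minimum [cmin] to be used. *)
Lemma cubic_div_le (R : realType) (D : spline_data R) (i : nat)
    (A B p q phi w m c : R) :
  phi \in `[0, 1] -> `|A| <= w -> `|B| <= w -> `|p| <= m -> `|q| <= m ->
  0 < c -> c <= cshape (Defs.shape D i) ->
  `|cubic_num (Defs.shape D i) A B p q phi / Qi D i phi| <=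
    (4 * c)^-1 * m + (4 * c)^-1 * w * (`|Defs.shape D i| + 4).
Proof.
move=> hphi hA hB hp hq c0 hc.
have cQ := le_trans hc (cshape_le_Qi D i hphi).
have Q0 : 0 < Qi D i phi by exact: lt_le_trans cQ.
have w0 : 0 <= w by exact: le_trans hA.
have m0 : 0 <= m by exact: le_trans hp.
rewrite normrM normfV (gtr0_norm Q0) ler_pdivrMr//.
apply: le_trans (cubic_num_le _ hphi hA hB hp hq) _.
have u4 := mul_onem_le4 phi.
have u0 : 0 <= phi * (1 - phi).
  by move: hphi; rewrite in_itv /= => /andP[? ?]; rewrite mulr_ge0// subr_ge0.
set u := phi * _ in u0 u4 *; set r := `|_|; have r0 : 0 <= r by exact: normr_ge0.
rewrite -mulrA -mulrDr.
apply: (@le_trans _ _ ((4 * c)^-1 * (m + w * (r + 4)) * c)).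
  have -> : (4 * c)^-1 * (m + w * (r + 4)) * c = m / 4 + w * (r / 4 + 1).
    by field; rewrite gt_eqF.
  rewrite addrC lerD ?ler_wpM2l//.
  have : r * u <= r / 4 by rewrite ler_wpM2l.
  lra.
by rewrite ler_wpM2l// mulr_ge0 ?invr_ge0 ?mulr_ge0 ?addr_ge0 ?mulr_ge0 ?addr_ge0// ltW.
Qed.

(* [|r| u] exceeds [r u] by at most 1/2 since [r > -1] and [u <= 1/4]; hence the
   numerator is controlled by [Q] itself, uniformly in the shape parameter. *)
Lemma cubic_div_le_unif (R : realType) (D : spline_data R) (i : nat)
    (A B p q phi w m c : R) :
  -1 < Defs.shape D i ->
  phi \in `[0, 1] -> `|A| <= w -> `|B| <= w -> `|p| <= m -> `|q| <= m ->
  0 < c -> c <= cshape (Defs.shape D i) ->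
  `|cubic_num (Defs.shape D i) A B p q phi / Qi D i phi| <=
    w * (1 + c^-1) + m * c^-1.
Proof.
move=> r1 hphi hA hB hp hq c0 hc.
have cQ := le_trans hc (cshape_le_Qi D i hphi).
have Q0 : 0 < Qi D i phi by exact: lt_le_trans cQ.
have w0 : 0 <= w by exact: le_trans hA.
have m0 : 0 <= m by exact: le_trans hp.
rewrite normrM normfV (gtr0_norm Q0) ler_pdivrMr//.
apply: le_trans (cubic_num_le _ hphi hA hB hp hq) _.
have u4 := mul_onem_le4 phi.
have u0 : 0 <= phi * (1 - phi).
  by move: hphi; rewrite in_itv /= => /andP[? ?]; rewrite mulr_ge0// subr_ge0.
have QE : Qi D i phi = 1 + (Defs.shape D i - 3) * (phi * (1 - phi)).
  by rewrite /Qi mulrA.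
(* This copy of [Q / c] pays both for the excess of [|r| u] over [r u] and for the term [m u]. *)
have c1 : 1 <= c^-1 * Qi D i phi by rewrite mulrC ler_pdivlMr// mul1r.
set u := phi * _ in u0 u4 QE *.
rewrite [leRHS]mulrDl -!mulrA lerD// ?ler_wpM2l//; last by lra.
rewrite [leRHS]mulrDl mul1r.
have : `|Defs.shape D i| * u <= Defs.shape D i * u + 1; last by lra.
by case: (ger0P (Defs.shape D i)) => _; nra.
Qed.

(** * Algebra of [R_i]: affine in the scaling factor, exact on constants *)

Lemma Ri_cubic (R : realType) (D : spline_data R) (i : nat) (alpha phi : R) :
  Ri D i alpha phi =
    cubic_num (Defs.shape D i) (value D i) (value D i.+1)
      (step D i * slope D i) (step D i * slope D i.+1) phi / Qi D i phi
    - alpha * (cubic_num (Defs.shape D i) (value D 1) (value D (npts D))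
      (slope D 1 * (xlast D - xfirst D))
      (slope D (npts D) * (xlast D - xfirst D)) phi / Qi D i phi).
Proof. by rewrite /Ri mulrA -mulrBl /Pi /cubic_num; congr (_ / _); ring. Qed.

(** Constants are reproduced: for [A = B = 1] and [p = q = 0] the cubic numerator is [Q_i] itself,
    so [v] can be subtracted from both end values. *)
Lemma Ri0_sub (R : realType) (D : spline_data R) (i : nat) (phi v : R) :
  Qi D i phi != 0 ->
  Ri D i 0 phi - v = cubic_num (Defs.shape D i) (value D i - v) (value D i.+1 - v)
      (step D i * slope D i) (step D i * slope D i.+1) phi / Qi D i phi.
Proof.
move=> Q0; rewrite Ri_cubic mul0r subr0; apply: (mulIf Q0).
by rewrite mulrBl !mulfVK// /cubic_num /Qi; ring.
Qed.

(** An affine function has a constant derivative, so a bound at one admissible [tau] controls the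
    whole coefficient of the scaling factor. *)
Lemma derive1_Ri (R : realType) (D : spline_data R) (i : nat) (tau phi : R) :
  derive1 (fun alpha => Ri D i alpha phi) tau =
    - (cubic_num (Defs.shape D i) (value D 1) (value D (npts D))
      (slope D 1 * (xlast D - xfirst D))
      (slope D (npts D) * (xlast D - xfirst D)) phi / Qi D i phi).
Proof.
under eq_fun do rewrite Ri_cubic.
set u := _ / _; set v := _ / _.
rewrite derive1E; have -> : (fun alpha : R => u - alpha * v) = cst u - v *: id.
  by apply/funext => x; rewrite /= !fctE /= /GRing.scale /= mulrC.
rewrite deriveB//= derive_cst sub0r deriveZ//= derive_id.
by rewrite /GRing.scale /= mulr1.
Qed.

(** * Knots, subintervals and extremal parameters *)

Lemma in_pieceE (R : realType) (D : spline_data R) (i : nat) :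
  (i \in index_iota 1 (npts D)) = piece D i.
Proof. by rewrite mem_index_iota. Qed.

Lemma interpolation_knots (R : realType) (a b : R) f kappa (D : spline_data R) :
  interpolation_data a b f kappa D ->
  forall i j, (1 <= i)%N -> (i <= j)%N -> (j <= npts D)%N -> knot D i <= knot D j.
Proof.
move=> [_ _ hk _ _] i j i1; elim: j => [|j IH]; first by rewrite leqn0 => /eqP->.
rewrite leq_eqVlt => /predU1P[->//|ij] jN.
by apply: le_trans (IH ij (ltnW jN)) (ltW (hk j _)); rewrite /piece jN (leq_trans i1).
Qed.

Lemma interpolation_lt (R : realType) (a b : R) f kappa (D : spline_data R) :
  interpolation_data a b f kappa D -> a < b.
Proof.
move=> hD; have := interpolation_knots hD; case: hD => N2 [<- <-] hk _ _ mono.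
have h1 : piece D 1 by rewrite /piece N2.
by apply: lt_le_trans (hk 1%N h1) (mono 2%N (npts D) _ _ _).
Qed.

Lemma interpolation_knot_in (R : realType) (a b : R) f kappa (D : spline_data R) i :
  interpolation_data a b f kappa D -> (1 <= i <= npts D)%N -> knot D i \in `[a, b].
Proof.
move=> hD /andP[i1 iN]; have mono := interpolation_knots hD.
case: hD => N2 [<- <-] _ _ _.
by rewrite in_itv /= /xfirst /xlast !mono// (leq_trans i1).
Qed.

(** Induction on the number of knots: [z] lies either in the last subinterval or to the left of the
    penultimate knot. *)
Lemma interpolation_piece (R : realType) (a b : R) f kappa (D : spline_data R) z :
  interpolation_data a b f kappa D -> z \in `[a, b] ->
  exists2 i, piece D i & z \in `[knot D i, knot D i.+1].
Proof.
case=> N2 [<- <-] _ _ _; rewrite /xfirst /xlast /piece.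
elim: (npts D) N2 => // n IH; rewrite ltnS leq_eqVlt => /predU1P[<-|n1].
  by exists 1%N.
rewrite in_itv /= => /andP[z1 z2]; have [zn|zn] := leP z (knot D n).
  have [|i /andP[i1 iN] zi] := IH n1; first by rewrite in_itv /= z1.
  by exists i; rewrite ?i1 ?(leq_trans iN).
by exists n; rewrite ?leqnn ?(ltnW n1)// in_itv /= z2 ltW.
Qed.

Lemma step_gt0 (R : realType) (a b : R) f kappa (D : spline_data R) i :
  interpolation_data a b f kappa D -> piece D i -> 0 < step D i.
Proof. by move=> [_ _ hk _ _] /hk; rewrite subr_gt0. Qed.

Lemma step_le_mesh (R : realType) (D : spline_data R) i :
  piece D i -> step D i <= mesh D.
Proof. by move=> hi; apply: le_bigmax_seq => //; rewrite in_pieceE. Qed.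

Lemma mesh_ge0 (R : realType) (D : spline_data R) : 0 <= mesh D.
Proof. exact: bigmax_ge_id. Qed.

Lemma slope_max_ge0 (R : realType) (D : spline_data R) : 0 <= slope_max D.
Proof. exact: bigmax_ge_id. Qed.

Lemma slope_le_max (R : realType) (D : spline_data R) i :
  (1 <= i <= npts D)%N -> `|slope D i| <= slope_max D.
Proof.
by move=> hi; apply: (@le_bigmax_seq _ _ _ _ _ _ xpredT (fun i => `|slope D i|));
  rewrite ?mem_index_iota.
Qed.

Lemma shape_le_max (R : realType) (D : spline_data R) i :
  piece D i -> `|Defs.shape D i| <= shape_max D.
Proof.
by move=> hi; apply: (@le_bigmax_seq _ _ _ _ _ _ xpredT (fun i => `|Defs.shape D i|));
  rewrite ?in_pieceE.
Qed.

Lemma scaling_max_ge0 (R : realType) (D : spline_data R) : 0 <= scaling_max D.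
Proof. exact: bigmax_ge_id. Qed.

Lemma scaling_le_max (R : realType) (D : spline_data R) i :
  piece D i -> `|scaling D i| <= scaling_max D.
Proof.
by move=> hi; apply: (@le_bigmax_seq _ _ _ _ _ _ xpredT (fun i => `|scaling D i|));
  rewrite ?in_pieceE.
Qed.

Lemma cmin_le (R : realType) (D : spline_data R) i :
  piece D i -> cmin D <= cshape (Defs.shape D i).
Proof.
by move=> hi; apply: (@ge_bigmin_seq _ _ _ _ _ _ xpredT (fun i => cshape (Defs.shape D i)));
  rewrite ?in_pieceE.
Qed.

Lemma cmin_gt0 (R : realType) (a b : R) f kappa (D : spline_data R) :
  interpolation_data a b f kappa D -> 0 < cmin D.
Proof.
case=> _ _ _ _ hr; rewrite /cmin big_nat.
elim/big_rec: _ => // i x /hr[_ r1] x0.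
by rewrite lt_min x0 cshape_gt0.
Qed.

(** Each [a_i] is [h_i / (b - a)]; this linear dependence on the mesh makes the scaling factors
    vanish in the limit. *)
Lemma scaling_max_le (R : realType) (a b : R) f kappa (D : spline_data R) :
  0 <= kappa -> interpolation_data a b f kappa D ->
  scaling_max D <= kappa * (mesh D / (b - a)).
Proof.
move=> k0 hD; have ab := interpolation_lt hD; case: (hD) => _ [ha hb] _ _ hr.
have ba0 : 0 <= (b - a)^-1 by rewrite invr_ge0 subr_ge0 ltW.
rewrite /scaling_max big_nat; apply: (big_ind (fun x => x <= _)).
(* The default value 0 of the maximum must obey the bound as well. *)
- by rewrite mulr_ge0// mulr_ge0// mesh_ge0.
- by move=> x y hx hy; rewrite ge_max hx.
- move=> i hi; have [hs _] := hr _ hi; apply: (le_trans hs).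
  by rewrite ler_wpM2l// /Defs.ratio hb ha ler_wpM2r// step_le_mesh.
Qed.

Lemma mesh_le (R : realType) (a b : R) f kappa (D : spline_data R) :
  interpolation_data a b f kappa D -> mesh D <= b - a.
Proof.
move=> hD; have ab := interpolation_lt hD.
rewrite /mesh big_nat; apply: (big_ind (fun x => x <= _)).
- by rewrite subr_ge0 ltW.
- by move=> x y hx hy; rewrite ge_max hx.
- move=> i /andP[i1 iN].
  have := interpolation_knot_in (i := i) hD; rewrite i1 (ltnW iN) => /(_ isT).
  have := interpolation_knot_in (i := i.+1) hD; rewrite iN => /(_ isT).
  by rewrite !in_itv /= => /andP[? ?] /andP[? ?]; rewrite lerB.
Qed.

Lemma scaling_max_le_kappa (R : realType) (a b : R) f kappa (D : spline_data R) :
  0 <= kappa -> interpolation_data a b f kappa D -> scaling_max D <= kappa.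
Proof.
move=> k0 hD; apply: le_trans (scaling_max_le k0 hD) _.
have ab := interpolation_lt hD.
by rewrite ler_piMr// ler_pdivrMr ?subr_gt0// mul1r (mesh_le hD).
Qed.

(** * Local coordinates and the maps [L_i] *)

Lemma local_coord_in01 (R : realType) (D : spline_data R) i z :
  knot D i < knot D i.+1 -> z \in `[knot D i, knot D i.+1] ->
  (z - knot D i) / step D i \in `[0, 1].
Proof.
move=> hk; rewrite !in_itv /= => /andP[z1 z2].
have s0 : 0 < step D i by rewrite subr_gt0.
apply/andP; split; last by rewrite ler_pdivrMr// mul1r lerD2r.
by rewrite divr_ge0// ?(ltW s0)// subr_ge0.
Qed.

(** The preimage is the point of [[a, b]] with the same relative position [t] as [z] has in its
    subinterval. Hence the equations for [S] and for [s] evaluate [R_i] at the same parameter. *)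
Lemma Lmap_onto (R : realType) (a b : R) f kappa (D : spline_data R) i z :
  interpolation_data a b f kappa D -> piece D i ->
  z \in `[knot D i, knot D i.+1] ->
  exists x, [/\ x \in `[a, b], Lmap D i x = z &
    (x - xfirst D) / (xlast D - xfirst D) = (z - knot D i) / step D i].
Proof.
move=> hD hi hz; have ab := interpolation_lt hD.
have s0 := step_gt0 hD hi; case: hD => _ [ha hb] hk _ _.
have := local_coord_in01 (hk i hi) hz; rewrite /Lmap /Defs.ratio ha hb.
set t := _ / _ => ht; exists (a + t * (b - a)).
have ba0 : 0 < b - a by rewrite subr_gt0.
split.
- move: ht; rewrite !in_itv /= => /andP[t0 t1].
  rewrite lerDl mulr_ge0 ?(ltW ba0)//= -lerBrDl.
  by rewrite ler_piMl// ltW.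
- have -> : z = knot D i + t * step D i by rewrite /t mulfVK ?gt_eqF// addrC subrK.
  by field; rewrite gt_eqF.
- by rewrite addrC addKr mulfK// gt_eqF.
Qed.

(** * Estimates of [R_i] on one subinterval *)

(** Supplies [w] and [m] for the cubic quotient of [R_i - f z]: the point [z] is within one mesh
    width of both ends of its subinterval. *)
Lemma interpolation_piece_bounds (R : realType) (a b : R) f kappa
    (D : spline_data R) i z :
  C1_on a b f -> interpolation_data a b f kappa D -> piece D i ->
  z \in `[knot D i, knot D i.+1] ->
  [/\ `|value D i - f z| <= modulus a b f (mesh D),
      `|value D i.+1 - f z| <= modulus a b f (mesh D),
      `|step D i * slope D i| <= mesh D * slope_max D &
      `|step D i * slope D i.+1| <= mesh D * slope_max D].
Proof.
move=> hf hD hi hz; have s0 := step_gt0 hD hi; have sm := step_le_mesh hi.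
have [i1 iN] := andP hi.
have hi0 : (1 <= i <= npts D)%N by rewrite i1 ltnW.
have hi1 : (1 <= i.+1 <= npts D)%N by [].
have ki := interpolation_knot_in hD hi0; have kj := interpolation_knot_in hD hi1.
have [_ _ _ hv _] := hD; rewrite !hv//.
move: (hz); rewrite in_itv /= => /andP[z1 z2].
have zab : z \in `[a, b].
  move: ki kj; rewrite !in_itv /= => /andP[ai _] /andP[_ jb].
  by rewrite (le_trans ai) ?(le_trans z2).
split; last 2 first.
- by rewrite normrM (gtr0_norm s0) ler_pM ?(ltW s0)// slope_le_max.
- by rewrite normrM (gtr0_norm s0) ler_pM ?(ltW s0)// slope_le_max.
- apply: le_modulus => //; apply: le_trans sm.
  by rewrite distrC ger0_norm ?subr_ge0// lerD2r.
- apply: le_modulus => //; apply: le_trans sm.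
  by rewrite ger0_norm ?subr_ge0// lerD2l lerN2.
Qed.

Lemma Ri0_error (R : realType) (a b : R) f kappa (D : spline_data R) i z :
  C1_on a b f -> interpolation_data a b f kappa D -> piece D i ->
  z \in `[knot D i, knot D i.+1] ->
  `|Ri D i 0 ((z - knot D i) / step D i) - f z| <=
    (4 * cmin D)^-1 * mesh D * slope_max D
    + (4 * cmin D)^-1 * modulus a b f (mesh D) * (shape_max D + 4).
Proof.
move=> hf hD hi hz; have hk : knot D i < knot D i.+1 by case: hD => _ _ ->.
have ht := local_coord_in01 hk hz.
have [w1 w2 m1 m2] := interpolation_piece_bounds hf hD hi hz.
have c0 := cmin_gt0 hD; have hc := cmin_le hi.
have Q0 : 0 < Qi D i ((z - knot D i) / step D i).
  exact: lt_le_trans (lt_le_trans c0 hc) (cshape_le_Qi D i ht).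
rewrite Ri0_sub ?gt_eqF//.
apply: le_trans (cubic_div_le ht w1 w2 m1 m2 c0 hc) _.
rewrite [X in X + _ <= _]mulrA lerD2l ler_wpM2l ?lerD2r ?shape_le_max//.
by rewrite mulr_ge0 ?invr_ge0 ?mulr_ge0 ?(ltW c0)// (le_trans _ w1).
Qed.

(** Version for the limit: [shape_max] is absent, and [c] may be a common lower bound for a whole
    sequence of meshes. *)
Lemma Ri0_error_unif (R : realType) (a b : R) f kappa (D : spline_data R) i z c :
  C1_on a b f -> interpolation_data a b f kappa D -> piece D i ->
  0 < c -> c <= cmin D -> z \in `[knot D i, knot D i.+1] ->
  `|Ri D i 0 ((z - knot D i) / step D i) - f z| <=
    modulus a b f (mesh D) * (1 + c^-1) + mesh D * slope_max D * c^-1.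
Proof.
move=> hf hD hi c0 hc hz; have hk : knot D i < knot D i.+1 by case: hD => _ _ ->.
have ht := local_coord_in01 hk hz.
have [w1 w2 m1 m2] := interpolation_piece_bounds hf hD hi hz.
have {}hc := le_trans hc (cmin_le hi).
have Q0 : 0 < Qi D i ((z - knot D i) / step D i).
  exact: lt_le_trans (lt_le_trans c0 hc) (cshape_le_Qi D i ht).
rewrite Ri0_sub ?gt_eqF//.
by apply: cubic_div_le_unif => //; case: hD => _ _ _ _ /(_ i hi)[].
Qed.

(* When [kappa = 0] the derivative hypothesis is vacuous and [Z0] may be
   negative, but then all the scaling factors vanish. *)
Lemma Ri_perturbation (R : realType) (a b : R) f kappa (D : spline_data R) i phi Z0 :
  0 <= kappa -> interpolation_data a b f kappa D -> dRi_bounded kappa D Z0 ->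
  piece D i -> phi \in `[0, 1] ->
  `|Ri D i (scaling D i) phi - Ri D i 0 phi| <= scaling_max D * Z0.
Proof.
move=> k0 hD hZ hi hphi; have := k0; rewrite le_eqVlt => /predU1P[kE|kpos].
  have sm0 : scaling_max D = 0.
    apply/eqP; rewrite eq_le scaling_max_ge0 andbT.
    by have := scaling_max_le k0 hD; rewrite -kE mul0r.
  have := scaling_le_max hi; rewrite sm0 normr_le0 => /eqP ->.
  by rewrite subrr normr0 mul0r.
have ab := interpolation_lt hD; have s0 := step_gt0 hD hi.
have a0 : 0 < kappa * Defs.ratio D i.
  case: hD => _ [ha hb] _ _ _.
  by rewrite mulr_gt0// /Defs.ratio ha hb divr_gt0// subr_gt0.
(* The midpoint is an arbitrary choice in the open range where the derivative is bounded. *)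
pose tau := kappa * Defs.ratio D i / 2.
have tau0 : 0 < tau by rewrite divr_gt0.
have := hZ i tau phi hi _ hphi; rewrite derive1_Ri normrN gtr0_norm// tau0 /=.
rewrite ltr_pdivrMr// ltr_pMr// ltr1n => /(_ isT) hle.
rewrite [Ri D i (scaling D i) phi]Ri_cubic [Ri D i 0 phi]Ri_cubic mul0r subr0.
by rewrite addrC addKr normrN normrM ler_pM// scaling_le_max.
Qed.

(** Here the data take the place of [Z0]: the coefficient of the scaling factor is a cubic quotient
    with end values [f a] and [f b] and with slopes multiplied by [b - a]. *)
Lemma dRi_bound_unif (R : realType) (a b : R) f kappa (D : spline_data R) i phi c F :
  interpolation_data a b f kappa D -> piece D i -> 0 < c -> c <= cmin D ->
  (forall x, x \in `[a, b] -> `|f x| <= F) -> phi \in `[0, 1] ->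
  `|Ri D i (scaling D i) phi - Ri D i 0 phi| <=
    scaling_max D * (F * (1 + c^-1) + slope_max D * (b - a) * c^-1).
Proof.
move=> hD hi c0 hc hF hphi; have ab := interpolation_lt hD.
have {}hc := le_trans hc (cmin_le hi).
rewrite [Ri D i (scaling D i) phi]Ri_cubic [Ri D i 0 phi]Ri_cubic mul0r subr0.
rewrite addrC addKr normrN normrM ler_pM// ?scaling_le_max//.
have h1 : (1 <= 1 <= npts D)%N by case: hD => /ltnW ->.
have hN : (1 <= npts D <= npts D)%N by rewrite leqnn andbT; case: hD => /ltnW.
have k1 := interpolation_knot_in hD h1; have kN := interpolation_knot_in hD hN.
case: hD => _ [ha hb] _ hv hr; have [_ r1] := hr i hi.
have ba0 : 0 <= b - a by rewrite subr_ge0 ltW.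
by apply: cubic_div_le_unif => //; rewrite ?hv ?hF// ha hb normrM (ger0_norm ba0)
  ler_wpM2r// slope_le_max.
Qed.

(** * Global estimates from the self-referential equation *)

Lemma FIF_classical_dist (R : realType) (a b : R) f kappa (D : spline_data R)
    (S s : R -> R) Z0 :
  C1_on a b f -> 0 <= kappa < 1 -> interpolation_data a b f kappa D ->
  is_spline_FIF D S -> is_classical_spline D s -> dRi_bounded kappa D Z0 ->
  forall z, z \in `[a, b] ->
  `|S z - s z| <= scaling_max D * (sup_norm a b s + Z0) / (1 - scaling_max D).
Proof.
move=> hf /andP[k0 k1] hD [hS hSeq] hs hZ; have ab := interpolation_lt hD.
have haD : xfirst D = a by case: hD => _ [].
have hbD : xlast D = b by case: hD => _ [].
rewrite haD hbD in hS hSeq.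
have [F hF] := C1_on_bounded hf; have [G hG] := C1_on_bounded hS.
set E := (4 * cmin D)^-1 * mesh D * slope_max D
    + (4 * cmin D)^-1 * modulus a b f (mesh D) * (shape_max D + 4).
(* Boundedness of [s], known only piecewise, comes from that of [f] and the interpolation error
   [E]. *)
have hsb x : x \in `[a, b] -> `|s x| <= E + F.
  move=> xab; have [i hi hz] := interpolation_piece hD xab.
  rewrite -[s x](subrK (f x)); apply: le_trans (ler_normD _ _) _.
  by rewrite lerD ?hF// (hs i)// (Ri0_error hf hD).
have hk1 := le_lt_trans (scaling_max_le_kappa k0 hD) k1.
apply: (@contraction_bound _ a b (fun x => S x - s x) _ _ (G + (E + F)));
    rewrite ?(ltW ab) ?scaling_max_ge0//.
  move=> x xab; apply: le_trans (ler_normB _ _) _.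
  by rewrite lerD ?hG ?hsb.
move=> z zab; have [i hi hz] := interpolation_piece hD zab.
have [x [xab xz xt]] := Lmap_onto hD hi hz; exists x => //.
have hk : knot D i < knot D i.+1 by case: hD => _ _ ->.
have ht := local_coord_in01 hk hz.
rewrite (hs i)// -[X in S X]xz hSeq// -haD -[in X in Ri D i _ X]hbD xt haD.
set t := (z - knot D i) / step D i in ht *.
rewrite -addrA; apply: le_trans (ler_normD _ _) _.
apply: le_trans (lerD (lexx _) (Ri_perturbation k0 hD hZ hi ht)) _.
(* The regrouping prepares [|S x| <= |S x - s x| + ||s||]. *)
have -> : scaling_max D * (sup_norm a b s + Z0) + scaling_max D * `|S x - s x| =
    scaling_max D * (`|S x - s x| + sup_norm a b s) + scaling_max D * Z0 by ring.
rewrite lerD2r normrM ler_pM// ?scaling_le_max//.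
rewrite -[S x in leLHS](subrK (s x)); apply: le_trans (ler_normD _ _) _.
by rewrite lerD2l (le_sup_norm hsb).
Qed.

(** At [z = L_i x] three errors add up: [R_i] at scaling 0 against [f], the change of scaling in
    [R_i], and [alpha_i * S x] with [|S x| <= |f x - S x| + F]. *)
Lemma FIF_error_unif (R : realType) (a b : R) f kappa (D : spline_data R)
    (S : R -> R) c F :
  C1_on a b f -> 0 <= kappa < 1 -> interpolation_data a b f kappa D ->
  is_spline_FIF D S -> 0 < c -> c <= cmin D ->
  (forall x, x \in `[a, b] -> `|f x| <= F) ->
  forall z, z \in `[a, b] ->
  `|f z - S z| <=
    (modulus a b f (mesh D) * (1 + c^-1) + mesh D * slope_max D * c^-1
     + scaling_max D * (F + (F * (1 + c^-1) + slope_max D * (b - a) * c^-1)))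
    / (1 - scaling_max D).
Proof.
move=> hf /andP[k0 k1] hD [hS hSeq] c0 hc hF; have ab := interpolation_lt hD.
have haD : xfirst D = a by case: hD => _ [].
have hbD : xlast D = b by case: hD => _ [].
rewrite haD hbD in hS hSeq; have [G hG] := C1_on_bounded hS.
have hk1 := le_lt_trans (scaling_max_le_kappa k0 hD) k1.
apply: (@contraction_bound _ a b (fun x => f x - S x) _ _ (F + G));
    rewrite ?(ltW ab) ?scaling_max_ge0//.
  move=> x xab; apply: le_trans (ler_normB _ _) _.
  by rewrite lerD ?hG ?hF.
move=> z zab; have [i hi hz] := interpolation_piece hD zab.
have [x [xab xz xt]] := Lmap_onto hD hi hz; exists x => //.
have hk : knot D i < knot D i.+1 by case: hD => _ _ ->.
have ht := local_coord_in01 hk hz.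
have e1 := Ri0_error_unif hf hD hi c0 hc hz.
have e2 := dRi_bound_unif hD hi c0 hc hF ht.
have -> : S z = scaling D i * S x
    + Ri D i (scaling D i) ((z - knot D i) / step D i).
  by rewrite -[in LHS]xz hSeq// -haD -[in X in Ri D i _ X]hbD xt.
move: e1 e2; set t := (z - knot D i) / step D i.
set A := _ + mesh D * slope_max D * _; set B := F * _ + _ => e1 e2.
have -> : f z - (scaling D i * S x + Ri D i (scaling D i) t) =
    - (Ri D i 0 t - f z) - ((Ri D i (scaling D i) t - Ri D i 0 t)
      + scaling D i * S x) by ring.
have -> : A + scaling_max D * (F + B) + scaling_max D * `|f x - S x| =
    A + (scaling_max D * B + scaling_max D * (`|f x - S x| + F)) by ring.
apply: le_trans (ler_normB _ _) (lerD _ _); first by rewrite normrN.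
apply: le_trans (ler_normD _ _) (lerD e2 _).
rewrite normrM ler_pM// ?scaling_le_max//.
rewrite -[S x in leLHS](subKr (f x)); apply: le_trans (ler_normB _ _) _.
by rewrite addrC lerD2l hF.
Qed.

(** * Error bound and uniform convergence *)

Unset Implicit Arguments.

Theorem theorem3p3 (R : realType) (a b : R) (f : R -> R) (kappa : R)
    (hf : C1_on a b f) (hkappa : 0 <= kappa < 1) :
  (forall (D : spline_data R) (S s : R -> R) (Z0 : R),
     interpolation_data a b f kappa D ->
     is_spline_FIF D S ->
     is_classical_spline D s ->
     dRi_bounded kappa D Z0 ->
     sup_norm a b (fun x => f x - S x) <=
       (4 * cmin D)^-1 * mesh D * slope_max D
       + (4 * cmin D)^-1 * modulus a b f (mesh D) * (shape_max D + 4)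
       + scaling_max D * (sup_norm a b s + Z0) / (1 - scaling_max D))
  /\
  (forall (D : nat -> spline_data R) (S : nat -> R -> R) (Z0 : nat -> R),
     (forall n, interpolation_data a b f kappa (D n)) ->
     (forall n, is_spline_FIF (D n) (S n)) ->
     (forall n, dRi_bounded kappa (D n) (Z0 n)) ->
     (exists2 c0 : R, 0 < c0 & forall n, c0 <= cmin (D n)) ->
     (exists M : R, forall n, slope_max (D n) <= M) ->
     mesh (D n) @[n --> \oo] --> (0 : R) ->
     {uniform `[a, b], S @ \oo --> f}).
Proof.
split=> [D S s Z0 hD hS hs hZ|D S Z0 hD hS _ [c c0 hc] [M hM] hmesh].
  apply: sup_norm_le => [|z zab]; first exact/ltW/(interpolation_lt hD).
  have [i hi hz] := interpolation_piece hD zab.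
  rewrite -[f z](subrK (s z)) -addrA; apply: le_trans (ler_normD _ _) (lerD _ _).
    by rewrite distrC (hs i)// (Ri0_error hf hD).
  by rewrite distrC (FIF_classical_dist hf hkappa hD).
have [F hF] := C1_on_bounded hf; have [k0 k1] := andP hkappa.
have ab := interpolation_lt (hD 0%N).
have M0 : 0 <= M := le_trans (slope_max_ge0 (D 0%N)) (hM 0%N).
have F0 : 0 <= F by apply: le_trans (hF a _) => //; rewrite bound_itvE ltW.
have ci : 0 <= c^-1 by rewrite invr_ge0 ltW.
have ba0 : 0 < b - a by rewrite subr_gt0.
pose K := F + (F * (1 + c^-1) + M * (b - a) * c^-1).
(* Majorant of the error with [slope_max <= M], [scaling_max] replaced by [kappa * mesh / (b - a)]
   in the numerator and by [kappa] in the denominator. What remains is fixed multiples of two null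
   sequences. *)
pose e n := modulus a b f (mesh (D n)) * ((1 + c^-1) / (1 - kappa))
  + mesh (D n) * ((M * c^-1 + kappa / (b - a) * K) / (1 - kappa)).
have e_cvg : e n @[n --> \oo] --> (0 : R).
  rewrite -[0 in X in _ --> X](addr0 0) -{1}(mul0r ((1 + c^-1) / (1 - kappa))).
  rewrite -{2}(mul0r ((M * c^-1 + kappa / (b - a) * K) / (1 - kappa))).
  apply: cvgD; apply: cvgMl => //.
  by apply: cvg_modulus => //; [exact: ltW | move=> n; exact: mesh_ge0].
have e_bound n z : z \in `[a, b] -> `|f z - S n z| <= e n.
  move=> zab.
  apply: le_trans (FIF_error_unif hf hkappa (hD n) (hS n) c0 (hc n) hF zab) _.
  have sm := scaling_max_le k0 (hD n); have smk := scaling_max_le_kappa k0 (hD n).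
  have sm0 := scaling_max_ge0 (D n).
  have sl0 := slope_max_ge0 (D n); have m0 := mesh_ge0 (D n).
  have w0 := modulus_ge0 hf (ltW ab) m0.
  have -> : e n = (modulus a b f (mesh (D n)) * (1 + c^-1) + mesh (D n) * M * c^-1
     + kappa * (mesh (D n) / (b - a)) * K) / (1 - kappa) by rewrite /e; ring.
  have slM : slope_max (D n) * (b - a) * c^-1 <= M * (b - a) * c^-1.
    by rewrite ler_wpM2r// ler_wpM2r// ltW.
  have c1 : 0 <= 1 + c^-1 by rewrite addr_ge0.
  have B0 : 0 <= F + (F * (1 + c^-1) + slope_max (D n) * (b - a) * c^-1).
    apply: addr_ge0 => //; apply: addr_ge0; first exact: mulr_ge0.
    by rewrite mulr_ge0// mulr_ge0// ltW.
  apply: ler_pM.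
  - by apply: addr_ge0; [apply: addr_ge0; rewrite !mulr_ge0|exact: mulr_ge0].
  - by rewrite invr_ge0 subr_ge0 (le_trans smk)// ltW.
  - rewrite lerD//; last first.
      by apply: ler_pM => //; rewrite lerD2l lerD2l.
    by rewrite lerD2l ler_wpM2r// ler_wpM2l.
  - by rewrite lef_pV2 ?posrE ?subr_gt0// ?lerD2l ?lerN2// (le_lt_trans smk).
(* As [e n] does not depend on the point, the pointwise bound yields a uniform neighbourhood. *)
move=> P /uniform_nbhs[E [entE EP]].
move: entE; rewrite -entourage_ballE => -[r /= r0 rE].
move/cvgrPdist_lt : e_cvg => /(_ r r0); apply: filterS => n.
rewrite sub0r normrN => en; apply: EP => y yab; apply: rE => /=.
by apply: le_lt_trans en; apply: le_trans (e_bound n y yab) (ler_norm _).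
Qed.
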